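(* Let $(X,\|\cdot\|)$ be a real normed linear space. Then $(X,\|\cdot\|)$ is an inner product space if and only if for all nonzero elements $x,y\in X$, $$\alpha[x,y]\leq\beta[x,y].$$
   Context: For nonzero elements $x,y$ of a real normed linear space $(X,\|\cdot\|)$, the angular distance between $x$ and $y$ is $$\alpha[x,y]=\left\|\frac{x}{\|x\|}-\frac{y}{\|y\|}\right\|,$$ and the skew-angular distance between $x$ and $y$ is $$\beta[x,y]=\left\|\frac{x}{\|y\|}-\frac{y}{\|x\|}\right\|.$$ Saying that $(X,\|\cdot\|)$ is an inner product space means that the norm is induced by an inner product, i.e. there is a real inner product $\langle\cdot,\cdot\rangle$ on $X$ with $\|x\|^2=\langle x,x\rangle$ for all $x\in X$. *)

(* Defs.v *)
From mathcomp Require Import all_boot all_order all_algebra sesquilinear.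
From mathcomp Require Import all_classical all_reals all_analysis.
Set Implicit Arguments.
Unset Strict Implicit.
Unset Printing Implicit Defensive.
Import Order.TTheory GRing.Theory Num.Theory.
Import numFieldNormedType.Exports.
Local Open Scope ring_scope.

Definition angular_distance (R : realType) (X : normedModType R) (x y : X) : R :=
  `| `|x|^-1 *: x - `|y|^-1 *: y |.

Definition skew_angular_distance (R : realType) (X : normedModType R) (x y : X) : R :=
  `| `|y|^-1 *: x - `|x|^-1 *: y |.

(* [{dot X for idfun}]: with [theta := idfun] (no conjugation), sesquilinear
   means bilinear and hermitian means symmetric, so these are exactly the
   real inner products on [X]. *)
Definition is_inner_product_space (R : realType) (X : normedModType R) : Prop :=
  exists dot : {dot X for @idfun R}, forall x : X, `|x| ^+ 2 = dot x x.

(* Main.v *)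
(* Applied to x = t u and y = - v with |u| = |v|, the hypothesis says
   |u + v| <= |t u + v / t| for t > 0, which is Lorch's condition.  Its first order
   part at t = 1 says that the isosceles relation |p + q| = |p - q| implies that s = 0
   minimizes |p + s q|.  The midpoint of any chord of the ball parallel to q is then a
   minimizer on its line; minimizers are unique (flat pieces of the sphere would extend
   indefinitely), so the norm is even along every such line and the linear exchange of two
   vectors of equal norm is an isometry of their plane.  These reflections give the
   Pythagorean identity for isosceles pairs, and every x decomposes as e + a y with
   (e, y) isosceles, so that polarization is bilinear. *)

Require Import Defs.
From HB Require Import structures.
From mathcomp Require Import all_boot all_order all_algebra sesquilinear.
From mathcomp Require Import all_classical all_reals all_analysis.
From mathcomp Require Import ring lra.
Import Order.TTheory GRing.Theory Num.Theory.
Import numFieldNormedType.Exports.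
Local Open Scope ring_scope.

(** * Normalization of linear combinations of three vectors *)

Lemma lin3_eq {R : realType} {V : normedModType R} (p q r : V) {v w : V} {a b c a' b' c' : R} :
  v = a *: p + b *: q + c *: r -> w = a' *: p + b' *: q + c' *: r ->
  a = a' -> b = b' -> c = c' -> v = w.
Proof. by move=> -> -> -> -> ->. Qed.

Lemma lin3_fst {R : realType} {V : normedModType R} (p q r : V) :
  p = 1 *: p + 0 *: q + 0 *: r.
Proof. by rewrite !scale0r !addr0 scale1r. Qed.

Lemma lin3_snd {R : realType} {V : normedModType R} (p q r : V) :
  q = 0 *: p + 1 *: q + 0 *: r.
Proof. by rewrite !scale0r addr0 add0r scale1r. Qed.

Lemma lin3_thd {R : realType} {V : normedModType R} (p q r : V) :
  r = 0 *: p + 0 *: q + 1 *: r.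
Proof. by rewrite !scale0r !add0r scale1r. Qed.

Lemma lin3_add {R : realType} {V : normedModType R} (p q r : V) (v w : V) (a b c a' b' c' : R) :
  v = a *: p + b *: q + c *: r -> w = a' *: p + b' *: q + c' *: r ->
  v + w = (a + a') *: p + (b + b') *: q + (c + c') *: r.
Proof. by move=> -> ->; rewrite !scalerDl addrACA [X in X + _ = _]addrACA. Qed.

Lemma lin3_opp {R : realType} {V : normedModType R} (p q r : V) (v : V) (a b c : R) :
  v = a *: p + b *: q + c *: r ->
  - v = (- a) *: p + (- b) *: q + (- c) *: r.
Proof. by move=> ->; rewrite !scaleNr !opprD. Qed.

Lemma lin3_scale {R : realType} {V : normedModType R} (p q r : V) (k : R) (v : V) (a b c : R) :
  v = a *: p + b *: q + c *: r ->
  k *: v = (k * a) *: p + (k * b) *: q + (k * c) *: r.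
Proof. by move=> ->; rewrite !scalerDr !scalerA. Qed.

Ltac lin3_reify :=
  lazymatch goal with
  | |- ?v = ?a *: ?p + ?b *: ?q + ?c *: ?r =>
    first [ constr_eq v p; exact (lin3_fst p q r)
          | constr_eq v q; exact (lin3_snd p q r)
          | constr_eq v r; exact (lin3_thd p q r)
          | lazymatch v with
            | _ + _ => eapply lin3_add; lin3_reify
            | - _ => eapply lin3_opp; lin3_reify
            | _ *: _ => eapply lin3_scale; lin3_reify
            end ]
  end.

(* Reduces an equation between linear combinations of p, q, r to its three
   coefficient equations; an atom may be repeated when fewer are needed. *)
Ltac lin3 p q r :=
  eapply (lin3_eq p q r); [lin3_reify | lin3_reify | | |].

(** * From Lorch's condition to Birkhoff orthogonality of isosceles pairs *)

Definition isosceles {R : realType} {X : normedModType R} (p q : X) : Prop :=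
  `|p + q| = `|p - q|.

Definition lorch {R : realType} (X : normedModType R) : Prop :=
  forall (u v : X) (t : R), `|u| = `|v| -> 0 < t ->
    `|u + v| <= `|t *: u + t^-1 *: v|.

Lemma lorch_of_angular {R : realType} {X : normedModType R} :
  (forall x y : X, x != 0 -> y != 0 ->
     angular_distance x y <= skew_angular_distance x y) -> lorch X.
Proof.
move=> H u v t uv t0.
have [u0|u0] := eqVneq u 0.
  move: uv; rewrite u0 normr0 => /esym/normr0_eq0 ->.
  by rewrite !addr0 normr0.
have nu : 0 < `|u| by rewrite normr_gt0.
have := H (t *: u) (- v).
rewrite oppr_eq0 scaler_eq0 negb_or (gt_eqF t0) u0 -normr_gt0 -uv nu => /(_ isT isT).
rewrite /angular_distance /skew_angular_distance normrN normrZ (gtr0_norm t0) -uv.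
have -> : (t * `|u|)^-1 *: (t *: u) - `|u|^-1 *: - v = `|u|^-1 *: (u + v).
  by lin3 u v v; field => //; rewrite ?(gt_eqF t0) ?(gt_eqF nu).
have -> : `|u|^-1 *: (t *: u) - (t * `|u|)^-1 *: - v = `|u|^-1 *: (t *: u + t^-1 *: v).
  by lin3 u v v; field => //; rewrite ?(gt_eqF t0) ?(gt_eqF nu).
by rewrite !normrZ ger0_norm ?invr_ge0// ler_pM2l ?invr_gt0.
Qed.

(* With u = p + q and v = p - q, Lorch's inequality bounds |p + s q| below by
   (1 - O(s^2)) |p|, whereas by convexity a value below |p| would force a linear decrease at 0. *)
Lemma isosceles_birkhoff_pos {R : realType} {X : normedModType R} {p q : X} {s : R} :
  lorch X -> isosceles p q -> 0 < s -> `|p| <= `|p + s *: q|.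
Proof.
move=> L pq s0; rewrite leNgt; apply/negP => lt.
set d := `|p| - `|p + s *: q|.
have d0 : 0 < d by rewrite subr_gt0.
have np : 0 < `|p| by apply: le_lt_trans lt.
(* The bound [e <= s] will keep [p + g *: q] on the segment from [p] to [p + s *: q]; the bound
   [e * s * |p| <= d] lets the linear decrease beat the quadratic error. *)
pose e := Num.min s (d / (s * `|p|)).
have sp0 : 0 < s * `|p| by rewrite mulr_gt0.
have e0 : 0 < e by rewrite /e lt_min s0 divr_gt0.
have es : e <= s by rewrite /e ge_min lexx.
have ed : e * (s * `|p|) <= d by rewrite -ler_pdivlMr// /e ge_min lexx orbT.
have := L (p + q) (p - q) (1 + e) pq (ltr_wpDl ler01 e0).
have D0 : 0 < 2 + 2 * e + e ^+ 2 by nra.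
(* Ratio of the [q]- to the [p]-coefficient in [(1 + e) *: (p + q) + (1 + e)^-1 *: (p - q)]. *)
pose g := (2 * e + e ^+ 2) / (2 + 2 * e + e ^+ 2).
have E1 : 1 + e != 0 by lra.
have Dn : 2 + 2 * e + e ^+ 2 != 0 by rewrite gt_eqF.
have ge : g * (2 + 2 * e + e ^+ 2) = 2 * e + e ^+ 2 by rewrite /g; field.
have g0 : 0 < g by rewrite /g divr_gt0//; nra.
have gs : g <= s.
  apply: le_trans es; rewrite /g ler_pdivrMr//; nra.
have -> : (1 + e) *: (p + q) + (1 + e)^-1 *: (p - q) =
   ((2 + 2 * e + e ^+ 2) / (1 + e)) *: (p + g *: q).
  by lin3 p q q; rewrite ?/g; field; rewrite ?E1 ?Dn.
have -> : p + q + (p - q) = 2%:R *: p by lin3 p q q; ring.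
have -> : p + g *: q = (1 - g / s) *: p + (g / s) *: (p + s *: q).
  by lin3 p q q; field; rewrite gt_eqF.
have C : `|(1 - g / s) *: p + (g / s) *: (p + s *: q)| <= `|p| - g / s * d.
  apply: (le_trans (ler_normD _ _)); rewrite [in X in X + _]normrZ [in X in _ + X]normrZ.
  have gs1 : g / s <= 1 by rewrite ler_pdivrMr// mul1r.
  have gs0 : 0 <= g / s by rewrite divr_ge0// ltW.
  rewrite (ger0_norm gs0) ger0_norm ?subr_ge0// /d.
  lra.
rewrite normrZ [in X in _ <= X]normrZ (gtr0_norm (_ : 0 < 2%:R))// gtr0_norm; last by rewrite divr_gt0// addr_gt0.
move=> B.
have {}B := le_trans B (ler_wpM2l (ltW (divr_gt0 D0 (addr_gt0 ltr01 e0))) C).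
move: B; rewrite mulrAC ler_pdivlMr ?addr_gt0//.
have -> : (2 + 2 * e + e ^+ 2) * (`|p| - g / s * d) =
  (2 + 2 * e + e ^+ 2) * `|p| - (2 * e + e ^+ 2) * d / s.
  by rewrite -ge; field; rewrite gt_eqF.
move=> B.
have {}B : (2 * e + e ^+ 2) * d / s <= e ^+ 2 * `|p| by lra.
move: B; rewrite ler_pdivrMr// leNgt => /negP; apply.
have := ler_wpM2l (ltW e0) ed; have := mulr_gt0 e0 d0; have := mulr_gt0 (mulr_gt0 e0 e0) d0.
rewrite !expr2; nra.
Qed.

Lemma isosceles_oppr {R : realType} {X : normedModType R} {p q : X} :
  isosceles p q -> isosceles p (- q).
Proof. by rewrite /isosceles opprK => ->. Qed.

Lemma isosceles_birkhoff {R : realType} {X : normedModType R} {p q : X} (s : R) :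
  lorch X -> isosceles p q -> `|p| <= `|p + s *: q|.
Proof.
move=> L pq; have [s0|s0|->] := ltgtP s 0; last by rewrite scale0r addr0.
- have sN : 0 < - s by rewrite oppr_gt0.
  by have := isosceles_birkhoff_pos L (isosceles_oppr pq) sN; rewrite scalerN scaleNr opprK.
- exact: isosceles_birkhoff_pos.
Qed.

Lemma isosceles_addsub {R : realType} {X : normedModType R} {u v : X} :
  `|u| = `|v| -> isosceles (u + v) (u - v).
Proof.
move=> uv; rewrite /isosceles.
have -> : u + v + (u - v) = 2%:R *: u by lin3 u v v; ring.
have -> : u + v - (u - v) = 2%:R *: v by lin3 u v v; ring.
by rewrite [LHS]normrZ [RHS]normrZ uv.
Qed.

(** * Minimizers of the norm on a line (Birkhoff orthogonality) and their uniqueness *)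

Definition line_min {R : realType} {X : normedModType R} (c d : X) : Prop :=
  forall s : R, `|c| <= `|c + s *: d|.

Lemma norm_flat_ge {R : realType} {X : normedModType R} {c d : X} (a b : R) :
  line_min c d -> 0 < a -> a * `|c| <= `|a *: c + b *: d|.
Proof.
move=> m a0; have -> : a *: c + b *: d = a *: (c + (b / a) *: d).
  by lin3 c d d; field; rewrite gt_eqF.
by rewrite normrZ gtr0_norm// ler_pM2l.
Qed.

Lemma norm_flat_le {R : realType} {X : normedModType R} {c d : X} (a b : R) :
  `|c + d| = `|c| -> 0 <= b -> b <= a -> `|a *: c + b *: d| <= a * `|c|.
Proof.
move=> cd b0 ba; have -> : a *: c + b *: d = (a - b) *: c + b *: (c + d).
  by lin3 c d d; ring.
apply: (le_trans (ler_normD _ _)).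
rewrite [in X in X + _]normrZ [in X in _ + X]normrZ cd.
by rewrite !ger0_norm ?subr_ge0//; lra.
Qed.

(* If the norm stayed constant on [c, c + d] but not up to c + (5/4) d, the chord
   from c + d/2 to the rescaling of c + (5/4) d would have its midpoint over the
   interior of the flat part while pointing strictly inside the sphere. *)
Lemma flat_extend {R : realType} {X : normedModType R} {c d : X} :
  lorch X -> line_min c d -> `|c + d| = `|c| ->
  `|c + (5%:R / 4%:R) *: d| = `|c|.
Proof.
move=> L m cd.
have [cE|c0] := eqVneq c 0.
  by move: cd; rewrite cE add0r normr0 => /normr0_eq0 ->; rewrite scaler0 addr0 normr0.
have nc : 0 < `|c| by rewrite normr_gt0.
apply/eqP; rewrite eq_le m andbT leNgt; apply/negP => lt.
pose k := `|c| / `|c + (5%:R / 4%:R) *: d|.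
have nr := lt_trans nc lt.
have k0 : 0 < k by rewrite divr_gt0.
have k1 : k < 1 by rewrite ltr_pdivrMr// mul1r.
pose u : X := c + 2%:R^-1 *: d; pose v : X := k *: (c + (5%:R / 4%:R) *: d).
have nu : `|u| = `|c|.
  apply/eqP; rewrite eq_le m andbT.
  have := @norm_flat_le _ _ c d 1 2%:R^-1 cd.
  by rewrite scale1r mul1r; apply; lra.
have nv : `|v| = `|c| by rewrite normrZ gtr0_norm// /k divfK// gt_eqF.
have I : isosceles (u + v) (u - v) by apply: isosceles_addsub; rewrite nu nv.
(* Since [0 < k < 1], this shift keeps the [d]-coefficient between 0 and the [c]-coefficient, so
   [norm_flat_le] applies, and it lowers the [c]-coefficient below [1 + k]: the norm drops below
   that of [u + v]. *)
have := isosceles_birkhoff (- 8%:R^-1) L I.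
rewrite {nu nv I}/u {}/v; clearbody k.
have -> : c + 2%:R^-1 *: d + k *: (c + (5%:R / 4%:R) *: d) = (1 + k) *: c + (2%:R^-1 + k * (5%:R / 4%:R)) *: d.
  by lin3 c d d; ring.
have -> : (1 + k) *: c + (2%:R^-1 + k * (5%:R / 4%:R)) *: d + - 8%:R^-1 *: (c + 2%:R^-1 *: d - k *: (c + (5%:R / 4%:R) *: d))
  = (1 + k - 8%:R^-1 * (1 - k)) *: c +
    (2%:R^-1 + k * (5%:R / 4%:R) - 8%:R^-1 * (2%:R^-1 - k * (5%:R / 4%:R))) *: d.
  by lin3 c d d; ring.
apply/negP; rewrite -ltNge.
have k10 : 0 < 1 + k by rewrite addr_gt0.
apply: (lt_le_trans _ (norm_flat_ge _ _ m k10)).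
apply: (le_lt_trans (norm_flat_le _ _ cd _ _)); [lra|lra|].
by rewrite ltr_pM2r//; lra.
Qed.

(** Iterating [flat_extend] gives norm [|c|] at every [c + (5/4)^n *: d], and these points are
    unbounded unless [d = 0]. *)
Lemma line_min_unique {R : realType} {X : normedModType R} {c d : X} :
  lorch X -> line_min c d -> `|c + d| = `|c| -> d = 0.
Proof.
move=> L m cd; apply/eqP; apply: contraT => d0.
have nd : 0 < `|d| by rewrite normr_gt0.
have it (n : nat) : `|c + (5%:R / 4%:R) ^+ n *: d| = `|c|.
  elim: n => [|n IH]; first by rewrite expr0 scale1r.
  rewrite exprS -scalerA; apply: flat_extend => // s.
  by rewrite scalerA.
have bern (n : nat) : n%:R / 4%:R <= (5%:R / 4%:R : R) ^+ n.
  elim: n => [|n IH]; first by rewrite mul0r expr0.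
  have : 1 <= (5%:R / 4%:R : R) ^+ n by rewrite exprn_ege1//; lra.
  by rewrite exprS -(natr1 n); lra.
have bd (n : nat) : n%:R <= 8%:R * `|c| / `|d|.
  rewrite ler_pdivlMr//.
  have := ler_normB (c + (5%:R / 4%:R) ^+ n *: d) c.
  rewrite it addrAC subrr add0r normrZ ger0_norm; last by rewrite exprn_ge0//; lra.
  have := ler_wpM2r (ltW nd) (bern n); lra.
have := bd (Num.truncn (8%:R * `|c| / `|d|)).+1.
rewrite leNgt => /negP []; exact: truncnS_gt.
Qed.

(** * Homogeneity of the isosceles relation *)

Lemma norm_line_continuous {R : realType} {X : normedModType R} (p q : X) :
  continuous (fun t : R => `|p + t *: q|).
Proof.
move=> t; apply: (@continuous_comp _ _ _ (fun t : R => p + t *: q) Num.norm).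
  apply: continuousD; first exact: cst_continuous.
  exact: scalel_continuous.
exact: norm_continuous.
Qed.

Lemma norm_line_IVT {R : realType} {X : normedModType R} (p : X) {q : X} {r : R} :
  q != 0 -> `|p| <= r -> exists2 t : R, 0 <= t & `|p + t *: q| = r.
Proof.
move=> q0 pr.
have nq : 0 < `|q| by rewrite normr_gt0.
(* Chosen so that [|M *: q| = |p| + r], whence [|p + M *: q| >= r]. *)
pose M := (`|p| + r) / `|q|.
have M0 : 0 <= M by rewrite divr_ge0// addr_ge0// (le_trans _ pr).
have MB : r <= `|p + M *: q|.
  have := ler_normB (p + M *: q) p.
  rewrite addrAC subrr add0r normrZ ger0_norm// /M divfK ?gt_eqF//; lra.
have C : {within `[0, M], continuous (fun t : R => `|p + t *: q|)}%classic.
  by apply: continuous_subspaceT; exact: norm_line_continuous.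
have [|t] := IVT M0 C (_ : Num.min _ _ <= r <= Num.max _ _).
  by rewrite scale0r addr0 ge_min pr/= le_max MB orbT.
by rewrite in_itv/= => /andP[t0 _] tr; exists t.
Qed.

Lemma isosceles_scale_pos {R : realType} {X : normedModType R} {p q : X} {s : R} :
  lorch X -> isosceles p q -> 0 < s -> isosceles p (s *: q).
Proof.
move=> L pq s0; rewrite /isosceles.
have [->|q0] := eqVneq q 0; first by rewrite scaler0 subr0 addr0.
have Nq0 : - q != 0 by rewrite oppr_eq0.
have [t t0 Ht] := norm_line_IVT p Nq0 (isosceles_birkhoff s L pq).
(* Midpoint and half-length of the chord from [p - t *: q] to [p + s *: q], whose ends have equal
   norm. *)
have I : isosceles (p + ((s - t) / 2%:R) *: q) (((s + t) / 2%:R) *: q).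
  rewrite /isosceles.
  have -> : p + ((s - t) / 2%:R) *: q + ((s + t) / 2%:R) *: q = p + s *: q.
    by lin3 p q q; field.
  have -> : p + ((s - t) / 2%:R) *: q - ((s + t) / 2%:R) *: q = p + t *: - q.
    by lin3 p q q; field.
  by rewrite Ht.
have st0 : s + t != 0 by rewrite gt_eqF// ltr_wpDr.
(* This multiple leads from the midpoint back to [p]; both points minimize the norm on the line, so
   they coincide and [t = s]. *)
have := isosceles_birkhoff ((t - s) / (s + t)) L I.
have -> : p + ((s - t) / 2%:R) *: q + ((t - s) / (s + t)) *: (((s + t) / 2%:R) *: q) = p.
  by lin3 p q q; field.
move=> le.
have E : `|p + ((s - t) / 2%:R) *: q| = `|p|.
  by apply/eqP; rewrite eq_le le isosceles_birkhoff.
have m : line_min p (((s - t) / 2%:R) *: q).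
  by move=> x; rewrite scalerA; exact: isosceles_birkhoff.
have /eqP := line_min_unique L m E.
rewrite scaler_eq0 (negbTE q0) orbF => /eqP Est.
have ts : t = s by lra.
by rewrite -scalerN -[in RHS]ts Ht.
Qed.

Lemma isosceles_scaler {R : realType} {X : normedModType R} {p q : X} (s : R) :
  lorch X -> isosceles p q -> isosceles p (s *: q).
Proof.
move=> L pq; have [s0|s0|->] := ltgtP s 0.
- have sN : 0 < - s by rewrite oppr_gt0.
  have := isosceles_oppr (isosceles_scale_pos L pq sN).
  by rewrite scaleNr opprK.
- exact: isosceles_scale_pos.
- by rewrite scale0r /isosceles subr0 addr0.
Qed.

Lemma isosceles_sym {R : realType} {X : normedModType R} {p q : X} :
  isosceles p q -> isosceles q p.
Proof. by rewrite /isosceles addrC => ->; rewrite distrC. Qed.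

Lemma isosceles_scale {R : realType} {X : normedModType R} {p q : X} (a b : R) :
  lorch X -> isosceles p q -> isosceles (a *: p) (b *: q).
Proof.
by move=> L pq; apply/isosceles_scaler/isosceles_sym/isosceles_scaler/isosceles_sym.
Qed.

(** * Reflections and the Pythagorean identity *)

Lemma ficken {R : realType} {X : normedModType R} {u v : X} (a b : R) :
  lorch X -> `|u| = `|v| -> `|a *: u + b *: v| = `|b *: u + a *: v|.
Proof.
move=> L uv.
(* Exchanging [u] and [v] fixes [u + v] and negates [u - v], a sign change that homogeneity of the
   isosceles relation makes isometric. *)
have I := isosceles_addsub uv.
have := isosceles_scale ((a + b) / 2%:R) ((a - b) / 2%:R) L I.
rewrite /isosceles.
have -> : ((a + b) / 2%:R) *: (u + v) + ((a - b) / 2%:R) *: (u - v) = a *: u + b *: v.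
  by lin3 u v v; field.
have -> // : ((a + b) / 2%:R) *: (u + v) - ((a - b) / 2%:R) *: (u - v) = b *: u + a *: v.
by lin3 u v v; field.
Qed.

(* The reflection swapping p and u / |u| is an isometry of the plane, so it carries q
   to a direction orthogonal to u; so does the rotated vector s p - q.  Orthogonal
   directions being unique, the two agree, which forces |u|^2 = 1 + s^2. *)
Lemma pythagoras_unit {R : realType} {X : normedModType R} {p q : X} (s : R) :
  lorch X -> `|p| = 1 -> `|q| = 1 -> isosceles p q -> `|p + s *: q| ^+ 2 = 1 + s ^+ 2.
Proof.
move=> L np nq pq.
have [->|s0] := eqVneq s 0; first by rewrite scale0r addr0 np expr0n addr0 expr1n.
have ev a b : `|a *: p + b *: q| = `|a *: p - b *: q| by exact: isosceles_scale.
have fi a b : `|a *: p + b *: q| = `|b *: p + a *: q| by apply: ficken => //; rewrite np nq.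
have nu1 := isosceles_birkhoff s L pq.
have [h hE] : exists h, h = `|p + s *: q| by eexists.
rewrite -hE in nu1 *; rewrite np in nu1.
have h0 : 0 < h by apply: lt_le_trans nu1.
have hn0 : h != 0 by rewrite gt_eqF.
(* With [w = h^-1 *: (p + s *: q)], the exchange of [p] and [w] sends [q = s^-1 *: (h *: w - p)] to
   [h^-1 *: (k *: p - q)]. *)
have [k kE] : exists k : R, k = (h ^+ 2 - 1) / s by eexists.
have I2 : isosceles (s *: p - q) (p + s *: q).
  rewrite /isosceles.
  have -> : s *: p - q + (p + s *: q) = (s + 1) *: p + (s - 1) *: q by lin3 p q q; ring.
  have -> : s *: p - q - (p + s *: q) = (s - 1) *: p - (s + 1) *: q by lin3 p q q; ring.
  by rewrite fi ev.
have pw : `|p| = `|h^-1 *: (p + s *: q)|.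
  by rewrite np normrZ -hE gtr0_norm ?invr_gt0// mulVf.
have I1 : isosceles (k *: p - q) (p + s *: q).
  rewrite /isosceles.
  have -> : k *: p - q + (p + s *: q) =
      h *: ((h / s) *: p + (1 - s^-1) *: (h^-1 *: (p + s *: q))).
    by lin3 p q q; rewrite ?kE; field; rewrite ?s0 ?hn0.
  have -> : k *: p - q - (p + s *: q) =
      h *: ((h / s) *: p + (- (1 + s^-1)) *: (h^-1 *: (p + s *: q))).
    by lin3 p q q; rewrite ?kE; field; rewrite ?s0 ?hn0.
  rewrite [LHS]normrZ [RHS]normrZ (ficken _ _ L pw) (ficken (h / s) _ L pw).
  have -> : (1 - s^-1) *: p + (h / s) *: (h^-1 *: (p + s *: q)) = p + q.
    by lin3 p q q; field; rewrite ?s0 ?hn0.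
  have -> : - (1 + s^-1) *: p + (h / s) *: (h^-1 *: (p + s *: q)) = - (p - q).
    by lin3 p q q; field; rewrite ?s0 ?hn0.
  by rewrite normrN pq.
have s21 : 1 + s ^+ 2 != 0 by rewrite gt_eqF// ltr_wpDr// sqr_ge0.
(* Solves [k *: p - q - A *: (p + s *: q) = B *: (s *: p - q)]. Both [k *: p - q] and
   [B *: (s *: p - q)] are then minimizers on one line, so [A = 0] and [k = s], that is
   [h ^+ 2 = 1 + s ^+ 2]. *)
pose A := (k - s) / (1 + s ^+ 2); pose B := 1 + A * s.
have E : k *: p - q + (- A) *: (p + s *: q) = B *: (s *: p - q).
  by lin3 p q q; rewrite /B /A; field.
have m : line_min (k *: p - q) ((- A) *: (p + s *: q)).
  by move=> x; rewrite scalerA; exact: isosceles_birkhoff.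
have le : `|B *: (s *: p - q)| <= `|k *: p - q|.
  have := isosceles_birkhoff A L (isosceles_scale B 1 L I2).
  have -> // : B *: (s *: p - q) + A *: (1 *: (p + s *: q)) = k *: p - q.
  by rewrite -E; lin3 p q q; ring.
have {}E : `|k *: p - q + (- A) *: (p + s *: q)| = `|k *: p - q|.
  by apply/eqP; rewrite eq_le E le/= -E; have := m 1; rewrite scale1r.
have /eqP := line_min_unique L m E.
rewrite scaler_eq0 -[_ + _ == 0]normr_eq0 -hE (negbTE hn0) orbF oppr_eq0 mulf_eq0 invr_eq0.
rewrite (negbTE s21) orbF subr_eq0 => /eqP ks.
have : k * s = h ^+ 2 - 1 by rewrite kE divfK.
by rewrite ks -expr2 => ->; ring.
Qed.

Lemma pythagoras {R : realType} {X : normedModType R} {p q : X} :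
  lorch X -> isosceles p q -> `|p + q| ^+ 2 = `|p| ^+ 2 + `|q| ^+ 2.
Proof.
move=> L pq.
have [->|p0] := eqVneq p 0; first by rewrite add0r normr0 expr0n add0r.
have [->|q0] := eqVneq q 0; first by rewrite addr0 normr0 expr0n addr0.
rewrite -normr_eq0 in p0; rewrite -normr_eq0 in q0.
have unit (x : X) : `|x| != 0 -> `|(`|x|^-1 *: x)| = 1.
  by move=> x0; rewrite normrZ ger0_norm ?invr_ge0// mulVf.
have := pythagoras_unit (`|q| / `|p|) L (unit _ p0) (unit _ q0) (isosceles_scale _ _ L pq).
have -> : `|p|^-1 *: p + (`|q| / `|p|) *: (`|q|^-1 *: q) = `|p|^-1 *: (p + q).
  by lin3 p q q; field; rewrite ?p0 ?q0.
rewrite normrZ ger0_norm ?invr_ge0// exprMn => H.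
have -> : `|p + q| ^+ 2 = `|p| ^+ 2 * (`|p|^-1 ^+ 2 * `|p + q| ^+ 2) by field.
by rewrite H; field.
Qed.

(** * Isosceles decomposition and bilinearity of the polarization *)

Lemma isosceles_decomp {R : realType} {X : normedModType R} (x y : X) :
  lorch X -> exists a : R, isosceles (x - a *: y) y.
Proof.
move=> L; have [->|y0] := eqVneq y 0; first by exists 0; rewrite /isosceles subr0 addr0.
have Ny0 : - y != 0 by rewrite oppr_eq0.
have ny : 0 < `|y| by rewrite normr_gt0.
(* A level strictly above [|x|] is cut by the line on both sides of [x], which makes [t] nonzero;
   the midpoint of this chord is the required [x - a *: y]. *)
pose r := `|x| + `|y|.
have xr : `|x| <= r by rewrite lerDl.
have [t t0 Ht] := norm_line_IVT x y0 xr.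
have [t' t'0 Ht'] := norm_line_IVT x Ny0 xr.
have tn : t != 0.
  by apply: contra_eq_neq Ht => ->; rewrite scale0r addr0 lt_eqF// ltrDl.
have tt0 : t + t' != 0 by rewrite gt_eqF// ltr_pwDl// lt_neqAle eq_sym tn.
have I : isosceles (x - ((t' - t) / 2%:R) *: y) (((t + t') / 2%:R) *: y).
  rewrite /isosceles.
  have -> : x - ((t' - t) / 2%:R) *: y + ((t + t') / 2%:R) *: y = x + t *: y.
    by lin3 x y y; field.
  have -> : x - ((t' - t) / 2%:R) *: y - ((t + t') / 2%:R) *: y = x + t' *: - y.
    by lin3 x y y; field.
  by rewrite Ht Ht'.
exists ((t' - t) / 2%:R).
have := isosceles_scaler (2%:R / (t + t')) L I.
by rewrite scalerA mulrA divfK// divff ?scale1r// pnatr_eq0.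
Qed.

(** Pythagoras for the pair [x - a *: y], [y]. Once the squared norm is quadratic along lines, the
    parallelogram law and the homogeneity of [polar] are polynomial identities. *)
Lemma sqr_norm_line {R : realType} {X : normedModType R} (x y : X) :
  lorch X -> exists e a : R,
    forall t : R, `|x + t *: y| ^+ 2 = e + (a + t) ^+ 2 * `|y| ^+ 2.
Proof.
move=> L; have [a I] := isosceles_decomp x y L.
exists (`|x - a *: y| ^+ 2), a => t.
have -> : x + t *: y = (x - a *: y) + (a + t) *: y by lin3 x y y; ring.
rewrite (pythagoras L (isosceles_scaler _ L I)) [`|(a + t) *: y|]normrZ exprMn.
by rewrite real_normK ?num_real.
Qed.

Lemma parallelogram {R : realType} {X : normedModType R} (x y : X) :
  lorch X -> `|x + y| ^+ 2 + `|x - y| ^+ 2 = 2%:R * (`|x| ^+ 2 + `|y| ^+ 2).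
Proof.
move=> L; have [e [a H]] := sqr_norm_line x y L.
have := H 1; have := H 0; have := H (-1).
by rewrite scale0r scale1r scaleN1r !addr0 => -> -> ->; ring.
Qed.

Definition polar {R : realType} {X : normedModType R} (x y : X) : R :=
  (`|x + y| ^+ 2 - `|x - y| ^+ 2) / 4%:R.

Lemma polarC {R : realType} {X : normedModType R} (x y : X) : polar x y = polar y x.
Proof. by rewrite /polar [x + y]addrC distrC. Qed.

Lemma polar_diag {R : realType} {X : normedModType R} (x : X) : polar x x = `|x| ^+ 2.
Proof.
rewrite /polar subrr normr0 -mulr2n -scaler_nat normrZ ger0_norm ?ler0n//.
by rewrite exprMn expr0n subr0; field.
Qed.

Lemma polarZr {R : realType} {X : normedModType R} (x y : X) (t : R) :
  lorch X -> polar x (t *: y) = t * polar x y.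
Proof.
move=> L; have [e [a H]] := sqr_norm_line x y L; rewrite /polar.
have := H t; have := H (- t); have := H 1; have := H (-1).
by rewrite scale1r scaleN1r scaleNr => -> -> -> ->; field.
Qed.

Lemma polarDr {R : realType} {X : normedModType R} (x y z : X) :
  lorch X -> polar x (y + z) = polar x y + polar x z.
Proof.
move=> L; rewrite !(polarC x).
pose m := 2%:R^-1 *: (y + z); pose n := 2%:R^-1 *: (y - z).
have -> : polar (y + z) x = 2%:R * polar m x.
  have -> : y + z = 2%:R *: m by rewrite /m; lin3 y z z; field.
  by rewrite polarC polarZr// polarC.
(* Jordan-von Neumann argument: [m + n = y] and [m - n = z], and subtracting the two identities
   cancels the terms in [|n|]. *)
have := parallelogram (m + x) n L; have := parallelogram (m - x) n L.
rewrite /polar.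
have -> : m + x + n = y + x by rewrite /m /n; lin3 x y z; field.
have -> : m + x - n = z + x by rewrite /m /n; lin3 x y z; field.
have -> : m - x + n = y - x by rewrite /m /n; lin3 x y z; field.
have -> : m - x - n = z - x by rewrite /m /n; lin3 x y z; field.
lra.
Qed.

Lemma inner_product_of_lorch {R : realType} {X : normedModType R} :
  lorch X -> is_inner_product_space X.
Proof.
move=> L.
have bil : bilinear_for *%R (@idfun R \; *%R) (@polar R X).
  split=> u a x y /=; first by rewrite !(polarC _ u) polarDr// polarZr.
  by rewrite polarDr// polarZr.
(* The exponent [false] selects the sign [+1], so this is plain symmetry. *)
have herm (x y : X) : polar x y = (-1) ^+ false * idfun (polar y x) :> R.
  by rewrite expr0 mul1r polarC.
have pos (x : X) : x != 0 -> 0 < polar x x.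
  by move=> x0; rewrite polar_diag exprn_gt0// normr_gt0.
pose M1 := @bilinear_isBilinear.Build R X X R *%R (@idfun R \; *%R) (@polar R X) bil.
pose M2 := isHermitianSesquilinear.Build R X false idfun (@polar R X) herm.
pose M3 := isDotProduct.Build R X (@polar R X) pos.
pose dot : {dot X for @idfun R} := HB.pack (@polar R X) M1 M2 M3.
by exists dot => x; rewrite /= polar_diag.
Qed.

(** * The inequality in inner product spaces, and the equivalence *)

Lemma angular_of_inner_product {R : realType} {X : normedModType R} {x y : X} :
  is_inner_product_space X -> x != 0 -> y != 0 ->
  angular_distance x y <= skew_angular_distance x y.
Proof.
move=> [dot dotE] x0 y0.
have sq (a b : R) : `|a *: x - b *: y| ^+ 2 =
    a ^+ 2 * `|x| ^+ 2 + b ^+ 2 * `|y| ^+ 2 - 2%:R * a * b * dot x y.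
  have dotC : dot y x = dot x y by rewrite (hermC dot) expr0 mul1r.
  have dotZ (u v : X) (c d : R) : dot (c *: u) (d *: v) = c * d * dot u v.
    by rewrite linearZl_LR linearZr_LR /= mulrA.
  have dotBl (u v w : X) : dot (u - v) w = dot u w - dot v w by exact: linearBl.
  have dotBr (u v w : X) : dot w (u - v) = dot w u - dot w v by exact: linearBr.
  by rewrite !dotE dotBl !dotBr !dotZ dotC; ring.
rewrite -ler_sqr ?nnegrE ?normr_ge0// /angular_distance /skew_angular_distance !sq.
have : 0 < `|x| by rewrite normr_gt0.
have : 0 < `|y| by rewrite normr_gt0.
move: `|x| `|y| (dot x y) => a b d b0 a0.
have an : a != 0 by rewrite gt_eqF.
have bn : b != 0 by rewrite gt_eqF.
rewrite -subr_ge0.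
(* The two squared distances have the same cross term in [d], so their difference depends on the
   norms [a] and [b] alone. *)
have -> : b^-1 ^+ 2 * a ^+ 2 + a^-1 ^+ 2 * b ^+ 2 - 2%:R * b^-1 * a^-1 * d -
  (a^-1 ^+ 2 * a ^+ 2 + b^-1 ^+ 2 * b ^+ 2 - 2%:R * a^-1 * b^-1 * d) =
  (a / b - b / a) ^+ 2 by field; rewrite ?an ?bn.
exact: sqr_ge0.
Qed.

Theorem theorem3p2 (R : realType) (X : normedModType R) :
  is_inner_product_space X <->
  (forall x y : X, x != 0 -> y != 0 ->
     angular_distance x y <= skew_angular_distance x y).
Proof.
split=> [ip x y|H]; first exact: angular_of_inner_product.
exact/inner_product_of_lorch/lorch_of_angular.
Qed.
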